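(* Suppose the following conditions hold. Connectivity of the graph/weight-matrix sequence: (i) each $A_k$ is row-stochastic with $[A_k]_{ij}>0$ if $(j,i)\in E_k$; (ii) $[A_k]_{ii}>0$ for all $i$; (iii) there is a constant $\eta>0$ such that $[A_k]_{ij}>0$ implies $[A_k]_{ij}>\eta$; (iv) $\{\mathcal G_k\}$ is $B$-strongly connected: there is an integer $B\ge1$ such that the graph $\big(V,\bigcup_{i=kB}^{(k+1)B-1}E_i\big)$ is strongly connected for all $k\ge0$. Common best hypothesis: the set $\Theta^*=\bigcap_{i=1}^n\Theta_i$, where $\Theta_i=\arg\min_{\theta\in\Theta} d(f^i(\cdot)\|l_i(\cdot|\theta))$, is non-empty. Priors and likelihoods: for all agents $i$, $\mu_0^i(\theta^* )>0$ for all $\theta^*\in\Theta^*$; and there is $\alpha>0$ (common to all agents) with $l_i(s^i|\theta)>\alpha$ for all $s^i\in\mathcal S^i$ and $\theta\in\Theta$. Let the beliefs $\mu_k^i$ be generated by $$\mu_{k+1}^i(\theta) = \frac{\prod_{j=1}^n\mu_k^j(\theta)^{[A_k]_{ij}}\, l_i(S_{k+1}^i|\theta)}{\sum_{p=1}^m \prod_{j=1}^n \mu_k^j(\theta_p)^{[A_k]_{ij}}\, l_i(S_{k+1}^i|\theta_p)},\qquad k\ge 0,\ i=1,\dots,n,\ \theta\in\Theta .$$ Then $$\lim_{k\to\infty}\mu_k^i(\theta)=0\quad\text{almost surely, for all }\theta\notin\Theta^*\text{ and all } i=1,\dots,n.$$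
   Context: There are $n$ agents. Agent $i$ observes at each time $k=1,2,\dots$ a random variable $S_k^i$ with values in a finite set $\mathcal S^i=\{s^i_1,\dots,s^i_{m_i}\}$. The variables $S_k^i$ are independent, and for each $i$ all $S_k^i$ ($k\ge1$) have the same distribution $f^i:\mathcal S^i\to[0,1]$. There is a finite set of hypotheses $\Theta=\{\theta_1,\dots,\theta_m\}$, and for each agent $i$ and $\theta\in\Theta$ a probability distribution $l_i(\cdot|\theta)$ on $\mathcal S^i$ (it is not required that $f^i$ equal some $l_i(\cdot|\theta)$). A belief is a probability distribution on $\Theta$; agent $i$ starts with a prior belief $\mu_0^i$. At each time $k\ge 0$ the agents communicate over a directed graph $\mathcal G_k=(V,E_k)$, $V=\{1,\dots,n\}$, with an associated $n\times n$ weight matrix $A_k$; $[A_k]_{ij}>0$ when $i$ receives information from $j$ at time $k$ (i.e. $(j,i)\in E_k$), and otherwise (for $i\ne j$) $[A_k]_{ij}=0$. The sequences $\{\mathcal G_k\}$, $\{A_k\}$ are deterministic. Here $d(p\|q)=\sum_s p_s\log(p_s/q_s)$ denotes the Kullback–Leibler divergence between discrete probability distributions $p$ and $q$, $\Theta_i=\arg\min_{\theta\in\Theta} d(f^i(\cdot)\|l_i(\cdot|\theta))$ is the set of hypotheses that best fit agent $i$'s observations, and $\Theta^*:=\bigcap_{i=1}^n\Theta_i$. *)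

(* Defs.v *)
From mathcomp Require Import all_boot all_order all_algebra finmap.
From mathcomp Require Import all_classical all_reals all_analysis.
Import Order.TTheory GRing.Theory Num.Theory.
Import numFieldNormedType.Exports.

Set Implicit Arguments.
Unset Strict Implicit.
Unset Printing Implicit Defensive.

Local Open Scope classical_set_scope.
Local Open Scope ring_scope.

Definition is_pmf (R : realType) (X : finType) (p : X -> R) : Prop :=
  (forall x, 0 <= p x) /\ \sum_x p x = 1.

(* Kullback-Leibler divergence, with the usual conventions
   0 log (0 / q) = 0 and p log (p / 0) = +oo for p != 0. *)
Definition kl_divergence (R : realType) (X : finType) (p q : X -> R) : \bar R :=
  (\sum_s (if p s == 0%R then 0
           else if q s == 0%R then +oo
           else (p s * ln (p s / q s))%:E))%E.

(* A finite-valued variable: the codomain carries its full power set as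
   sigma-algebra. *)
Definition discrete_rv (d : measure_display) (T : measurableType d)
    (U : finType) (X : T -> U) : Prop :=
  forall A : set U, measurable (X @^-1` A).

Definition mutually_independent (R : realType) (d : measure_display)
    (T : measurableType d) (P : probability T R) (I : choiceType)
    (U : I -> finType) (X : forall i, T -> U i) : Prop :=
  forall (J : {fset I}) (A : forall i, set (U i)),
    P (\bigcap_(i in [set` J]) (X i @^-1` A i)) =
    (\prod_(i <- J) P (X i @^-1` A i))%E.

Section Network.
Context {R : realType} {n : nat}.
Implicit Types (A : 'M[R]_n) (E : nat -> rel 'I_n).

Definition row_stochastic A : Prop :=
  (forall i j, 0 <= A i j) /\ (forall i, \sum_j A i j = 1).

(* [e u v] is the edge from u to v: v receives information from u. *)
Definition strongly_connected (e : rel 'I_n) : Prop :=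
  forall u v, connect e u v.

Definition window_union E (a b : nat) : rel 'I_n :=
  fun u v => [exists t : 'I_b, (a <= t)%N && E t u v].

Definition uniformly_strongly_connected E (B : nat) : Prop :=
  forall k, strongly_connected (window_union E (k * B) (k.+1 * B)).

End Network.

Section Hypotheses.
Context {R : realType} {n : nat} {Sig : 'I_n -> finType} {Theta : finType}.
Variables (f : forall i, Sig i -> R) (l : forall i, Theta -> Sig i -> R).
Arguments f : clear implicits.
Arguments l : clear implicits.

Definition best_fit (i : 'I_n) : set Theta :=
  [set th | forall th',
     (kl_divergence (f i) (l i th) <= kl_divergence (f i) (l i th'))%E].

Definition common_best_fit : set Theta := \bigcap_(i in [set: 'I_n]) best_fit i.

End Hypotheses.

Section Beliefs.
Context {R : realType} {n : nat} {Sig : 'I_n -> finType} {Theta : finType}.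
Variables (l : forall i, Theta -> Sig i -> R) (A : nat -> 'M[R]_n).
Variable mu0 : 'I_n -> Theta -> R.
Arguments l : clear implicits.

Definition unnormalized_update (W : 'M[R]_n) (mu : 'I_n -> Theta -> R)
    (i : 'I_n) (s : Sig i) (th : Theta) : R :=
  (\prod_j (mu j th `^ W i j)) * l i th s.

(* [s k i] is the signal of agent i at time k; [s 0] is never used, signals
   starting at time 1. *)
Fixpoint belief (s : nat -> forall i, Sig i) (k : nat) (i : 'I_n) (th : Theta)
    : R :=
  if k is k'.+1 then
    unnormalized_update (A k') (belief s k') (s k'.+1 i) th /
    \sum_p unnormalized_update (A k') (belief s k') (s k'.+1 i) p
  else mu0 i th.

End Beliefs.

(* Main.v *)
Require Import Defs.
From mathcomp Require Import all_boot all_order all_algebra finmap.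
From mathcomp Require Import all_classical all_reals all_analysis.
From mathcomp Require Import measurable_realfun ring lra zify.
Import Order.TTheory GRing.Theory Num.Theory.
Import numFieldNormedType.Exports.
Local Open Scope classical_set_scope.
Local Open Scope ring_scope.

(** Fix a hypothesis th outside Theta* and some ths in Theta*.  The normalizing
    sums cancel in the ratio mu_k(th) / mu_k(ths), so the logarithm of this ratio
    obeys the linear recursion psi_{k+1} = A_k psi_k + L_{k+1}, where L_{k+1}^j is
    the log-likelihood ratio of th against ths at the signal of agent j.  The mean
    of L^j is the divergence for ths minus the divergence for th: it is never
    positive, since ths is a best fit for every agent, and it is negative for at
    least one agent j0, since th is not a best fit for everybody.

    Unrolling the recursion, psi_k is a sum of the independent variables L_t^j
    with the deterministic weights [A_{k-1} ... A_t]_{ij} (avg_llrE).  By uniform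
    strong connectivity and the positive diagonals, every entry of such a product
    is at least a constant delta > 0 as soon as it has M factors
    (transition_mixing).  Hence all but the last M observations of the
    agent j0 push psi_k down by a fixed amount on average.

    The fluctuations around this mean are controlled by an exponential moment,
    uniformly in the weights.  By independence, E exp(lam psi_k) is a product
    of moment generating functions of bounded variables, each at most
    exp(lam * weight * mean + O(lam^2)) (mgf_bound).  For small lam the linear
    gain beats the quadratic error, and E exp(lam psi_k) decays geometrically
    (expectation_expR_avg_llr_decay).  The expectations being summable,
    exp(lam psi_k) tends to 0 almost surely (summable_expectation_cvg0), and
    for lam <= 1 it dominates mu_k(th) up to a constant (belief_le_avg_llr).

    A prior may vanish at th, in which case the log ratio does not exist.  This is
    why psi starts from 0 and the argument only uses the upper bound
    mu_k(th) <= exp(C + psi_k) mu_k(ths), which survives zero beliefs. *)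

(** * Expectation of products of independent finite-valued variables *)

Section IndependentProducts.
Context {R : realType} {d : measure_display} {T : measurableType d}.
Context (P : probability T R) {I : choiceType} {U : I -> finType}.
Context (X : forall i, T -> U i) (p : forall i, U i -> R).
Hypothesis X_rv : forall i, discrete_rv (X i).
Hypothesis X_law : forall i u, P (X i @^-1` [set u]) = (p i u)%:E.
Hypothesis X_indep : mutually_independent P X.

Lemma discrete_rv_measurable_comp i (g : U i -> R) :
  measurable_fun [set: T] (g \o X i).
Proof. by move=> _ Y _; rewrite setTI comp_preimage; exact: X_rv. Qed.

Lemma expectation_prod_indicator (s : seq I) (A : forall i, set (U i)) :
  uniq s ->
  (\int[P]_w (\prod_(i <- s) \1_(A i) (X i w))%:E =
   \prod_(i <- s) P (X i @^-1` A i))%E.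
Proof.
move=> us.
have -> : (\prod_(i <- s) P (X i @^-1` A i) =
           \prod_(i <- seq_fset tt s) P (X i @^-1` A i))%E.
  by apply/esym/perm_big; rewrite -[X in perm_eq _ X](undup_id us) seq_fset_perm.
rewrite -X_indep.
have inJ i : [set` seq_fset tt s] i <-> i \in s.
  by rewrite -(seq_fsetE tt s).
have mcap : measurable (\bigcap_(i in [set` seq_fset tt s]) (X i @^-1` A i)).
  by apply: fin_bigcap_measurable => // i _; exact: X_rv.
rewrite -[X in P X]setIT -integral_indic//; apply: eq_integral => w _.
congr (_%:E); rewrite indicE.
case: (boolP (w \in _)) => [|/negP wA].
  rewrite inE => wA; rewrite big_seq big1// => i is_; rewrite indicE mem_set//.
  by apply: wA; apply/inJ.
suff /existsNP[i /not_implyP[/= is_ nA]] :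
    ~ forall i, i \in s -> (X i @^-1` A i) w.
  by rewrite (big_rem i)//= indicE memNset ?mul0r.
by move=> h; apply: wA; apply/mem_set => i /inJ; exact: h.
Qed.

(** Interpolates between products of indicators, where the claim is the
    definition of independence, and products of arbitrary functions: a factor
    g i (X i) is the sum over u of g i u times the indicator of X i = u, and each
    of these indicators moves to the second list. *)
Lemma expectation_prod_split (s1 s2 : seq I) (g : forall i, U i -> R)
    (A : forall i, set (U i)) :
  (forall i u, 0 <= g i u) -> uniq (s1 ++ s2) ->
  (\int[P]_w ((\prod_(i <- s1) g i (X i w)) *
              \prod_(i <- s2) \1_(A i) (X i w))%:E =
   (\prod_(i <- s1) \sum_u p i u * g i u)%:E *
   \prod_(i <- s2) P (X i @^-1` A i))%E.
Proof.
move=> g0; elim: s1 s2 A => [|i s1 IH] s2 A.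
  move=> us2; rewrite big_nil mul1e -expectation_prod_indicator//.
  by apply: eq_integral => w _; rewrite big_nil mul1r.
move=> us; have us' : uniq (s1 ++ i :: s2).
  by rewrite -[i :: s2]cat1s uniq_catCA.
have is2 : i \notin s2.
  by move: us => /= /andP[]; rewrite mem_cat negb_or => /andP[].
pose F u w := ((\prod_(j <- s1) g j (X j w)) *
               \prod_(j <- i :: s2) \1_(dfwith A i [set u] j) (X j w)).
have away : forall j, j \in s2 -> i != j.
  by move=> j js2; apply: contraNneq is2 => ->.
have F0 u w : 0 <= F u w.
  by rewrite mulr_ge0// prodr_ge0.
have mF u : measurable_fun [set: T] (F u).
  by apply: measurable_funM; apply: measurable_prod => j _;
    exact: discrete_rv_measurable_comp.
transitivity (\int[P]_w (\sum_(u : U i) (g i u)%:E * (F u w)%:E))%E.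
  apply: eq_integral => w _.
  under [RHS]eq_bigr do rewrite -EFinM.
  rewrite sumEFin; congr (_%:E).
  (* Only the value u = X i w contributes. *)
  rewrite big_cons (bigD1 (X i w))//= [X in _ = _ + X]big1 ?addr0.
    rewrite /F big_cons dfwithin indicE mem_set// mul1r -mulrA.
    congr (_ * (_ * _)); apply: eq_big_seq => j js2.
    by rewrite dfwithout// away.
  move=> u uX; rewrite /F big_cons dfwithin indicE memNset ?mul0r ?mulr0//=.
  by move/esym/eqP; exact/negP.
rewrite ge0_integral_sum//=; last 2 first.
- by move=> u; apply/measurable_EFinP; apply: measurable_funM.
- by move=> u w _; rewrite mule_ge0 ?lee_fin.
rewrite big_cons mulr_suml.
transitivity (\sum_(u : U i) ((g i u)%:E *
    ((\prod_(j <- s1) \sum_v p j v * g j v)%:E *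
     ((p i u)%:E * \prod_(j <- s2) P (X j @^-1` A j)))))%E.
  apply: eq_bigr => u _; rewrite ge0_integralZl ?lee_fin//; last 2 first.
  - exact/measurable_EFinP.
  - by move=> w _; rewrite lee_fin.
  rewrite IH// big_cons dfwithin X_law; congr (_ * (_ * (_ * _)))%E.
  by apply: eq_big_seq => j js2; rewrite dfwithout// away.
have -> : (\prod_(j <- s2) P (X j @^-1` A j) =
           (\prod_(j <- s2) fine (P (X j @^-1` A j)))%:E)%E.
  rewrite -prodEFin; apply: eq_bigr => j _; rewrite fineK//.
  by apply: fin_num_measure; exact: X_rv.
under [LHS]eq_bigr do rewrite -!EFinM.
rewrite sumEFin -EFinM; congr (_%:E).
by rewrite mulr_suml; apply: eq_bigr => u _; ring.
Qed.

Lemma expectation_prod_independent (s : seq I) (g : forall i, U i -> R) :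
  (forall i u, 0 <= g i u) -> uniq s ->
  (\int[P]_w (\prod_(i <- s) g i (X i w))%:E =
   (\prod_(i <- s) \sum_u p i u * g i u)%:E)%E.
Proof.
move=> g0 us.
have := @expectation_prod_split s [::] g (fun=> setT) g0.
rewrite cats0 => /(_ us); rewrite big_nil mule1 => <-.
by apply: eq_integral => w _; rewrite big_nil mulr1.
Qed.

End IndependentProducts.

(** * Almost sure convergence from summable expectations *)

(** The sum of the Y k has a finite expectation, so it is finite almost surely,
    and the terms of a convergent series tend to 0. *)
Lemma summable_expectation_cvg0 (R : realType) (d : measure_display)
    (T : measurableType d) (P : probability T R) (Y : nat -> T -> R)
    (C rho : R) :
  (forall k, measurable_fun [set: T] (Y k)) ->
  (forall k w, 0 <= Y k w) ->
  0 <= rho < 1 ->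
  (forall k, (\int[P]_w (Y k w)%:E <= (C * rho ^+ k)%:E)%E) ->
  {ae P, forall w, Y k w @[k --> \oo] --> (0 : R)}.
Proof.
move=> mY Y0 /andP[rho0 rho1] leY.
have mYE k : measurable_fun [set: T] (fun w => (Y k w)%:E).
  exact/measurable_EFinP.
have YE0 k w : (0 <= (Y k w)%:E)%E by rewrite lee_fin.
have finite_sum : (\int[P]_w (\sum_(k <oo) (Y k w)%:E) < +oo)%E.
  rewrite integral_nneseries//.
  apply: (@le_lt_trans _ _ (\sum_(k <oo) (C * rho ^+ k)%:E)%E).
    by apply: lee_nneseries => k *; [apply: integral_ge0 => w _|exact: leY].
  have rho_norm : `|rho| < 1 by rewrite ger0_norm.
  have /cvg_lim := @cvg_geometric_series R C rho rho_norm.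
  move=> /(_ (@Rhausdorff R)) lim_geo.
  rewrite (_ : limn _ = (C / (1 - rho))%:E) ?ltry//.
  rewrite -lim_geo -EFin_lim; last exact: is_cvg_geometric_series.
  by congr (limn _); apply/funext => m; rewrite /= /series/= sumEFin.
have integrable_sum : P.-integrable setT (fun w => \sum_(k <oo) (Y k w)%:E)%E.
  apply/integrableP; split.
    by apply: ge0_emeasurable_sum => // k w _ _; exact: YE0.
  rewrite (eq_integral (fun w => \sum_(k <oo) (Y k w)%:E)%E)// => w _.
  by rewrite gee0_abs//; exact: nneseries_ge0.
apply: filterS (integrable_ae measurableT integrable_sum) => w /(_ I) fin_w.
apply: cvg_series_cvg_0; apply: nnseries_is_cvg => //.
by rewrite ltey_eq fin_w.
Qed.

(** * Moment generating functions *)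

(** From 1 - x <= exp(- x) one gets exp x <= 1 / (1 - x), and the quadratic
    majorizes 1 / (1 - x) as long as x <= 1/2. *)
Lemma expR_le_quadratic (R : realType) (x : R) :
  x <= 2^-1 -> expR x <= 1 + x + 2 * x ^+ 2.
Proof.
move=> x_half; have inv_bound : 1 - x <= expR (- x) by exact: expR_ge1Dx.
have x1 : 0 < 1 - x by lra.
have ex : expR x <= (1 - x)^-1.
  by rewrite -[x in expR x]opprK expRN lef_pV2 ?posrE ?expR_gt0.
apply: (le_trans ex); rewrite -[leLHS]mul1r ler_pdivrMr//.
have -> : (1 + x + 2 * x ^+ 2) * (1 - x) = 1 + x ^+ 2 * (1 - 2 * x) by ring.
by rewrite lerDl mulr_ge0 ?sqr_ge0//; lra.
Qed.

(** A weak form of Hoeffding's lemma: only the linear term and the order of the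
    quadratic one matter, so the constant 2 is not optimized. *)
Lemma mgf_bound (R : realType) (X : finType) (p Y : X -> R) (K y : R) :
  is_pmf p -> (forall x, `|Y x| <= K) -> 0 <= y -> y * K <= 2^-1 ->
  \sum_x p x * expR (y * Y x) <=
  expR (y * (\sum_x p x * Y x) + 2 * (y * K) ^+ 2).
Proof.
move=> [p0 p1] YK y0 yK.
apply: le_trans (expR_ge1Dx _).
apply: (@le_trans _ _
  (\sum_x (p x + y * (p x * Y x) + p x * (2 * (y * K) ^+ 2)))).
  apply: ler_sum => x _.
  have yYK : `|y * Y x| <= y * K by rewrite normrM (ger0_norm y0) ler_wpM2l.
  have yY_half : y * Y x <= 2^-1.
    by rewrite (le_trans (ler_norm _))// (le_trans yYK).
  have yY2 : (y * Y x) ^+ 2 <= (y * K) ^+ 2.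
    by rewrite -[leLHS]real_normK ?num_real// lerXn2r ?nnegrE//
      (le_trans (normr_ge0 _) yYK).
  rewrite (_ : _ + _ = p x * (1 + y * Y x + 2 * (y * K) ^+ 2)); last by ring.
  rewrite ler_wpM2l// (le_trans (expR_le_quadratic _ _ yY_half))//.
  by rewrite lerD2l ler_wpM2l.
by rewrite !big_split/= -mulr_sumr -mulr_suml p1 mul1r addrA.
Qed.

(** * Products of weight matrices *)

Lemma connect_exit (V : finType) (e : rel V) (S : {set V}) (x y : V) :
  connect e x y -> x \in S -> y \notin S ->
  exists u u', [/\ u \in S, u' \notin S & e u u'].
Proof.
move=> /connectP[p].
elim: p x => [x /= _ -> -> //|a p IH x /= /andP[xa ap] yE xS yS].
by have [aS|aS] := boolP (a \in S); [exact: (IH a)|exists x, a].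
Qed.

Section TransitionMatrices.
Context {R : realType} {n : nat}.
Implicit Types (A : nat -> 'M[R]_n).

(** The product A_{t+m-1} ... A_t: later matrices act on the left, since
    A_k averages the values held at time k. *)
Fixpoint transition A (t m : nat) : 'M[R]_n :=
  if m is m'.+1 then A (t + m')%N *m transition A t m' else 1%:M.

Lemma transition_row_stochastic A t m :
  (forall k, row_stochastic (A k)) -> row_stochastic (transition A t m).
Proof.
move=> A_stoch; elim: m => [|m [IH0 IH1]] /=.
  split=> [i j|i]; first by rewrite mxE ler0n.
  rewrite (bigD1 i)//= mxE eqxx big1 ?addr0// => j /negPf ji.
  by rewrite mxE eq_sym ji.
have [A0 A1] := A_stoch (t + m)%N; split=> [i j|i].
  by rewrite mxE sumr_ge0// => u _; rewrite mulr_ge0.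
under eq_bigr do rewrite mxE.
rewrite exchange_big/= -[RHS](A1 i); apply: eq_bigr => u _.
by rewrite -mulr_sumr IH1 mulr1.
Qed.

Section Positivity.
Context (A : nat -> 'M[R]_n) (E : nat -> rel 'I_n) (B : nat) (eta : R).
Hypothesis A_stoch : forall k, row_stochastic (A k).
Hypothesis A_diag : forall k i, 0 < A k i i.
Hypothesis A_edge : forall k i j, E k j i -> 0 < A k i j.
Hypothesis eta_gt0 : 0 < eta.
Hypothesis A_lower : forall k i j, 0 < A k i j -> eta < A k i j.
Hypothesis B_gt0 : (0 < B)%N.
Hypothesis E_conn : uniformly_strongly_connected E B.

Let A_ge0 k i j : 0 <= A k i j. Proof. by case: (A_stoch k) => + _. Qed.

Let transition_ge0 t m i j : 0 <= transition A t m i j.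
Proof. by case: (transition_row_stochastic _ t m A_stoch) => + _. Qed.

Lemma transition_step_ge t m i u j :
  A (t + m)%N i u * transition A t m u j <= transition A t m.+1 i j.
Proof.
rewrite [leRHS]mxE (bigD1 u)//= lerDl sumr_ge0// => v _.
by rewrite mulr_ge0.
Qed.

Lemma transition_pos_mono t m m' i j : (m <= m')%N ->
  0 < transition A t m i j -> 0 < transition A t m' i j.
Proof.
move=> /subnK <-; elim: (m' - m)%N => [//|q IH] pos.
rewrite addSn; apply: lt_le_trans (transition_step_ge _ _ _ i _).
by rewrite mulr_gt0// IH.
Qed.

(** A positive entry of the product contains a path of m positive weights, and
    each weight exceeds eta. *)
Lemma transition_pos_lower t m i j :
  0 < transition A t m i j -> eta ^+ m <= transition A t m i j.
Proof.
elim: m i => [|m IH] i.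
  by rewrite /= mxE; case: (i == j); rewrite ?ltxx.
move=> pos.
have [u /andP[Aiu pos_u]] : exists u, (0 < A (t + m)%N i u) &&
    (0 < transition A t m u j).
  apply/existsP; apply: contraLR pos => /existsPn no_u.
  rewrite -leNgt mxE big1// => u _; apply/eqP; rewrite mulf_eq0.
  by have := no_u u; rewrite negb_and -!leNgt => /orP[] le0; apply/orP;
    [left|right]; rewrite eq_le le0 ?A_ge0 ?transition_ge0.
apply: le_trans (transition_step_ge _ _ _ u _).
rewrite exprS; apply: ler_pM; rewrite ?exprn_ge0 ?(ltW eta_gt0)//.
  exact/ltW/A_lower.
exact: IH.
Qed.

(** The agents whose m-step average from time t involves the value of j. *)
Let reached t j m := [set i : 'I_n | 0 < transition A t m i j]%SET.

Let reached_mono t j m m' :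
  (m <= m')%N -> reached t j m \subset reached t j m'.
Proof.
move=> mm'; apply/fintype.subsetP => i; rewrite !inE.
exact: transition_pos_mono.
Qed.

Let reached_self t j m : j \in reached t j m.
Proof.
apply: (fintype.subsetP (reached_mono _ _ _ _ (leq0n m))).
by rewrite inE /= mxE eqxx ltr01.
Qed.

(** Strong connectivity over the window gives an edge leaving the reached set at
    some time s of the window.  Its source is still reached at time s because the
    diagonals are positive, so its target is reached at time s + 1. *)
Lemma reached_grows t j q : (t <= q * B)%N ->
  (reached t j (q * B - t) != [set: 'I_n]%SET) ->
  reached t j (q * B - t) \proper reached t j (q.+1 * B - t).
Proof.
move=> tq notfull.
have qq1 : (q * B - t <= q.+1 * B - t)%N.
  by rewrite leq_sub2r// leq_mul2r leqnSn orbT.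
have [v nv] : exists v, v \notin reached t j (q * B - t).
  apply/existsP; apply: contraNT notfull => /existsPn h.
  apply/eqP/setP => v; rewrite finset.in_setT.
  by have := h v; rewrite negbK.
have [u [u' [ru nru' /existsP[s /andP[qs Esuu']]]]] :=
  connect_exit _ _ _ _ _ (E_conn q j v) (reached_self _ _ _) nv.
rewrite properE reached_mono//=.
apply/subsetPn; exists u' => //.
have ts : (t <= s)%N by exact: leq_trans qs.
apply: (fintype.subsetP
  (reached_mono _ _ (s.+1 - t) _ (leq_sub2r t (ltn_ord s)))).
rewrite subSn// inE; apply: lt_le_trans (transition_step_ge _ _ _ u _).
rewrite subnKC// mulr_gt0 ?A_edge//.
have := fintype.subsetP (reached_mono t j _ _ (leq_sub2r t qs)) _ ru.
by rewrite inE.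
Qed.

(** The first window starting after t starts at t + B at the latest, and n
    windows are then enough to reach everybody; hence (n + 1) B steps. *)
Lemma transition_pos t i j m : (n.+1 * B <= m)%N -> 0 < transition A t m i j.
Proof.
move=> nBm; pose q := (t %/ B).+1.
have tq : (t <= q * B)%N by rewrite ltnW// ltn_ceil.
have qt : (q * B <= t + B)%N by rewrite mulSn addnC leq_add2r leq_trunc_div.
have grow c : reached t j ((q + c) * B - t) = [set: 'I_n]%SET \/
              (c < #|reached t j ((q + c) * B - t)|)%N.
  elim: c => [|c IH].
    by right; rewrite card_gt0; apply/set0Pn; exists j; exact: reached_self.
  have tqc : (t <= (q + c) * B)%N.
    by rewrite (leq_trans tq)// leq_mul2r leq_addr orbT.
  rewrite addnS.
  have [full|notfull] := eqVneq (reached t j ((q + c) * B - t)) [set: 'I_n]%SET.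
    left; apply/eqP; rewrite -finset.subTset -full; apply: reached_mono.
    by rewrite leq_sub2r// leq_mul2r leqnSn orbT.
  right; have {}IH : (c < #|reached t j ((q + c) * B - t)|)%N.
    by case: IH => // full; rewrite full eqxx in notfull.
  exact: leq_ltn_trans IH (proper_card (reached_grows _ _ _ tqc notfull)).
have full : reached t j ((q + n) * B - t) = [set: 'I_n]%SET.
  case: (grow n) => // /leq_trans /(_ (max_card _)).
  by rewrite card_ord ltnn.
apply: (@transition_pos_mono t ((q + n) * B - t)).
  apply: leq_trans nBm; rewrite leq_subLR mulnDl mulSn addnA leq_add2r.
  exact: qt.
by have := finset.in_setT i; rewrite -full inE.
Qed.

(** At m = (n + 1) B steps positivity and the path bound combine.  Later rows are
    convex combinations of earlier ones, so the bound does not deteriorate as m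
    grows. *)
Lemma transition_mixing t m i j : (n.+1 * B <= m)%N ->
  eta ^+ (n.+1 * B) <= transition A t m i j.
Proof.
move=> /subnK <-; elim: (m - _)%N i => [|q IH] i.
  by rewrite add0n transition_pos_lower// transition_pos.
have [_ A1] := A_stoch (t + (q + n.+1 * B))%N.
rewrite addSn /= mxE -[leLHS]mul1r -(A1 i) mulr_suml.
by apply: ler_sum => u _; rewrite ler_wpM2l.
Qed.

End Positivity.
End TransitionMatrices.

(** * Divergences and log-likelihood ratios *)

Lemma kl_divergenceE (R : realType) (X : finType) (p q : X -> R) :
  (forall x, 0 < q x) ->
  kl_divergence p q = (\sum_x p x * ln (p x / q x))%:E.
Proof.
move=> q0; rewrite /kl_divergence -sumEFin; apply: eq_bigr => x _.
by case: eqP => [->|_]; rewrite ?mul0r// gt_eqF.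
Qed.

(** The mean under p of the log-likelihood ratio of q' against q is the difference
    of the two divergences: this is how best fits enter the argument. *)
Lemma log_loss_drift (R : realType) (X : finType) (p q q' : X -> R) :
  is_pmf p -> (forall x, 0 < q x) -> (forall x, 0 < q' x) ->
  \sum_x p x * ln (p x / q x) =
  \sum_x p x * ln (p x / q' x) + \sum_x p x * ln (q' x / q x).
Proof.
move=> [p0 _] q0 q'0; rewrite -big_split/=.
apply: eq_bigr => x _; rewrite -mulrDr.
have [->|px] := eqVneq (p x) 0; first by rewrite !mul0r.
have px0 : 0 < p x by rewrite lt_def px p0.
by congr (_ * _); rewrite !ln_div ?posrE//; ring.
Qed.

(** * The linear recursion for log-ratios of beliefs *)

Section WeightedSums.
Context {R : realType} {n : nat} (A : nat -> 'M[R]_n) (L : nat -> 'I_n -> R).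

(** [L t] is the contribution of the signals of time [t.+1]. *)
Fixpoint avg_llr (k : nat) (i : 'I_n) : R :=
  if k is k'.+1 then \sum_j A k' i j * avg_llr k' j + L k' i else 0.

Lemma avg_llrE k i :
  avg_llr k i =
  \sum_(0 <= t < k) \sum_j transition A t.+1 (k - t.+1) i j * L t j.
Proof.
elim: k i => [|k IH] i; first by rewrite big_geq.
rewrite big_nat_recr//= subnn; congr (_ + _); last first.
  rewrite (bigD1 i)//= mxE eqxx mul1r big1 ?addr0// => j /negPf ji.
  by rewrite mxE eq_sym ji mul0r.
under eq_bigr => j _ do rewrite IH mulr_sumr.
rewrite exchange_big/=; apply: eq_big_nat => t /andP[_ tk].
rewrite subSn//= subnKC//.
under [RHS]eq_bigr => j _ do rewrite mxE mulr_suml.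
rewrite [RHS]exchange_big/=; apply: eq_bigr => u _.
by rewrite mulr_sumr; apply: eq_bigr => j _; rewrite mulrA.
Qed.

End WeightedSums.

Section BeliefBounds.
Context {R : realType} {n : nat} {Sig : 'I_n -> finType} {Theta : finType}.
Context (l : forall i, Theta -> Sig i -> R) (A : nat -> 'M[R]_n).
Context (mu0 : 'I_n -> Theta -> R) (s : nat -> forall i, Sig i).
Context (th ths : Theta).
Hypothesis A_stoch : forall k, row_stochastic (A k).
Hypothesis l_gt0 : forall i th s, 0 < l i th s.
Hypothesis mu0_pmf : forall i, is_pmf (mu0 i).
Hypothesis mu0_ths : forall i, 0 < mu0 i ths.

Let mu := belief l A mu0 s.

Definition llr i (x : Sig i) : R := ln (l i th x / l i ths x).

Let update_ge0 k i th' :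
  (forall j th', 0 <= mu k j th') ->
  0 <= unnormalized_update l (A k) (mu k) (s k.+1 i) th'.
Proof.
by move=> mu_ge0; rewrite mulr_ge0 ?(ltW (l_gt0 _ _ _))// prodr_ge0// => j _;
  exact: powR_ge0.
Qed.

Let update_gt0 k i :
  (forall j, 0 < mu k j ths) ->
  0 < unnormalized_update l (A k) (mu k) (s k.+1 i) ths.
Proof.
by move=> mu_gt0; rewrite mulr_gt0// prodr_gt0// => j _; exact: powR_gt0.
Qed.

Let normalizer_gt0 k i : (forall j th', 0 <= mu k j th') ->
  (forall j, 0 < mu k j ths) ->
  0 < \sum_p unnormalized_update l (A k) (mu k) (s k.+1 i) p.
Proof.
move=> mu_ge0 mu_gt0; rewrite (bigD1 ths)//= ltr_pwDl ?update_gt0//.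
by rewrite sumr_ge0// => p _; exact: update_ge0.
Qed.

(** Positivity at ths keeps every normalizing sum positive, so that the divisions
    in the update are genuine. *)
Lemma belief_ge0_gt0 k :
  (forall i th', 0 <= belief l A mu0 s k i th') /\
  (forall i, 0 < belief l A mu0 s k i ths).
Proof.
elim: k => [|k [IH0 IH1]].
  by split=> // i th'; case: (mu0_pmf i) => + _; exact.
split=> [i th'|i] /=.
  by rewrite divr_ge0 ?update_ge0// ltW// normalizer_gt0.
by rewrite divr_gt0 ?update_gt0// normalizer_gt0.
Qed.

Lemma belief_le1 k i th' : belief l A mu0 s k i th' <= 1.
Proof.
case: k => [|k] /=.
  have [mu_ge0 mu_sum] := mu0_pmf i.
  by rewrite -mu_sum (bigD1 th')//= lerDl sumr_ge0.
have [mu_ge0 mu_gt0] := belief_ge0_gt0 k.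
rewrite ler_pdivrMr ?normalizer_gt0// mul1r (bigD1 th')//= lerDl sumr_ge0//.
by move=> p _; exact: update_ge0.
Qed.

(** Both hypotheses share the normalizing sum, so a bound on the ratio passes to
    weighted geometric means, whose exponents sum to 1 and thus leave the constant
    C unchanged.  Stated as a product, it also covers beliefs equal to 0. *)
Lemma belief_ratio_le (C : R) :
  (forall i, mu0 i th <= expR C * mu0 i ths) ->
  forall k i, belief l A mu0 s k i th <=
    expR (C + avg_llr A (fun t j => llr j (s t.+1 j)) k i) *
    belief l A mu0 s k i ths.
Proof.
move=> mu0C; elim=> [|k IH] i /=; first by rewrite addr0.
have [mu_ge0 mu_gt0] := belief_ge0_gt0 k.
rewrite mulrA ler_wpM2r// ?invr_ge0 ?(ltW (normalizer_gt0 _ _ _ _))//.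
have [A0 A1] := A_stoch k.
set psi := avg_llr _ _ k.
rewrite /unnormalized_update.
have -> : l i th (s k.+1 i) = expR (llr i (s k.+1 i)) * l i ths (s k.+1 i).
  by rewrite /llr lnK ?posrE ?divr_gt0// divfK// gt_eqF.
rewrite addrA expRD mulrACA ler_wpM2r//.
  by rewrite mulr_ge0 ?expR_ge0 ?(ltW (l_gt0 _ _ _)).
have -> : C + \sum_j A k i j * psi j = \sum_j (C + psi j) * A k i j.
  rewrite -[in LHS](mulr1 C) -(A1 i) mulr_sumr -big_split/=.
  by apply: eq_bigr => j _; ring.
rewrite expR_sum -big_split/=; apply: ler_prod => j _.
rewrite powR_ge0/= expRM -powRM ?expR_ge0 ?(ltW (mu_gt0 _))//.
by rewrite ge0_ler_powR ?nnegrE ?mulr_ge0 ?expR_ge0 ?(ltW (mu_gt0 _)) ?mu_ge0//.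
Qed.

(** With x = C + psi, the belief is at most min(1, exp x), and
    min(1, exp x) <= exp(lam x) when lam lies in [0, 1]. *)
Lemma belief_le_avg_llr (C lam : R) : 0 <= lam <= 1 ->
  (forall i, mu0 i th <= expR C * mu0 i ths) ->
  forall k i, belief l A mu0 s k i th <=
    expR (lam * C) *
    expR (lam * avg_llr A (fun t j => llr j (s t.+1 j)) k i).
Proof.
move=> /andP[lam0 lam1] mu0C k i; rewrite -expRD -mulrDr.
set x := C + _.
have [x0|x0] := leP 0 x.
  by rewrite (le_trans (belief_le1 _ _ _))// -expR0 ler_expR mulr_ge0.
rewrite (le_trans (belief_ratio_le _ mu0C k i))// -/x.
apply: (@le_trans _ _ (expR x)).
  by rewrite -[leRHS]mulr1 ler_wpM2l ?expR_ge0 ?belief_le1.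
by rewrite ler_expR -[leLHS]mul1r ler_wnM2r// ltW.
Qed.

End BeliefBounds.

(** * Geometric decay of the exponential moment *)

Lemma weighted_mgf_prod_le (R : realType) (n : nat) (Sig : 'I_n -> finType)
    (f Y : forall j, Sig j -> R) (w : 'I_n -> R) (K lam : R) :
  (forall j, is_pmf (f j)) -> (forall j u, `|Y j u| <= K) ->
  (forall j, 0 <= w j <= 1) -> 0 <= K -> 0 <= lam -> lam * K <= 2^-1 ->
  \prod_j \sum_u f j u * expR (lam * (w j * Y j u)) <=
  expR (lam * (\sum_j w j * \sum_u f j u * Y j u) +
        n%:R * (2 * (lam * K) ^+ 2)).
Proof.
move=> f_pmf YK w01 K0 lam0 lamK.
have -> : n%:R * (2 * (lam * K) ^+ 2) = \sum_(j < n) 2 * (lam * K) ^+ 2.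
  by rewrite sumr_const card_ord mulr_natl.
rewrite mulr_sumr -big_split/= expR_sum; apply: ler_prod => j _.
have [w0 w1] := andP (w01 j); have [f0 _] := f_pmf j.
rewrite sumr_ge0/=; last by move=> u _; rewrite mulr_ge0 ?expR_ge0.
have wK : lam * w j * K <= lam * K.
  by rewrite -mulrA ler_wpM2l// -[leRHS]mul1r ler_wpM2r.
under eq_bigr do rewrite mulrA.
apply: le_trans (mgf_bound _ _ _ _ K _ (f_pmf j) (YK j) _ (le_trans wK lamK)) _.
  exact: mulr_ge0.
rewrite ler_expR mulrA lerD2l ler_wpM2l// lerXn2r ?nnegrE ?mulr_ge0//.
Qed.

Lemma sum_recent_le (M k : nat) :
  (\sum_(0 <= t < k) (k - t.+1 < M) <= M)%N.
Proof.
rewrite big_nat_rev/= (@eq_big_nat _ _ _ _ _ _ (fun t => nat_of_bool (t < M)%N)).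
  suff : (\sum_(0 <= t < k) (t < M) <= minn k M)%N.
    by move=> /leq_trans; apply; exact: geq_minr.
  elim: k => [|k IH]; first by rewrite big_geq.
  by rewrite big_nat_recr//=; lia.
by move=> t /andP[_ tk]; congr (nat_of_bool (_ < _)%N); lia.
Qed.

Section Decay.
Context {R : realType} {d : measure_display} {T : measurableType d}.
Context (P : probability T R) {n : nat} {Sig : 'I_n -> finType}.
Context (S : nat -> forall i : 'I_n, T -> Sig i).
Context (f Y : forall i : 'I_n, Sig i -> R) (A : nat -> 'M[R]_n).
Hypothesis f_pmf : forall i, is_pmf (f i).
Hypothesis S_rv : forall k i, discrete_rv (S k.+1 i).
Hypothesis S_law : forall k i s, P (S k.+1 i @^-1` [set s]) = (f i s)%:E.
Hypothesis S_indep : mutually_independent P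
  (fun ki : nat * 'I_n => S ki.1.+1 ki.2).
Hypothesis A_stoch : forall k, row_stochastic (A k).

Let psi k i w := avg_llr A (fun t j => Y j (S t.+1 j w)) k i.

Let times k : seq (nat * 'I_n) :=
  [seq (t, j) | t <- index_iota 0 k, j <- index_enum 'I_n].

Let factor lam k i (ki : nat * 'I_n) (u : Sig ki.2) :=
  expR (lam * (transition A ki.1.+1 (k - ki.1.+1) i ki.2 * Y ki.2 u)).

Lemma expR_avg_llrE lam k i w :
  expR (lam * psi k i w) =
  \prod_(ki <- times k) factor lam k i ki (S ki.1.+1 ki.2 w).
Proof.
rewrite /psi avg_llrE mulr_sumr expR_sum big_allpairs; apply: eq_bigr => t _.
by rewrite mulr_sumr expR_sum.
Qed.

Lemma expR_avg_llr_measurable lam k i :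
  measurable_fun [set: T] (fun w => expR (lam * psi k i w)).
Proof.
rewrite (funext (expR_avg_llrE lam k i)); apply: measurable_prod => ki _.
exact: (discrete_rv_measurable_comp
  (fun ki : nat * 'I_n => S ki.1.+1 ki.2) (fun ki => S_rv ki.1 ki.2)).
Qed.

Lemma expectation_expR_avg_llr lam k i :
  (\int[P]_w (expR (lam * psi k i w))%:E =
   (\prod_(0 <= t < k) \prod_j \sum_u f j u *
     expR (lam * (transition A t.+1 (k - t.+1) i j * Y j u)))%:E)%E.
Proof.
under eq_integral do rewrite expR_avg_llrE.
rewrite (expectation_prod_independent P
  (fun ki : nat * 'I_n => S ki.1.+1 ki.2) (fun ki : nat * 'I_n => f ki.2)).
- by rewrite big_allpairs.
- by move=> ki; exact: S_rv.
- by move=> ki u; exact: S_law.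
- exact: S_indep.
- by move=> ki u; exact: expR_ge0.
- apply: allpairs_uniq; [exact: iota_uniq|exact: index_enum_uniq|].
  by move=> [? ?] [? ?].
Qed.

(** Observations older than M steps contribute at most - 2 a to the exponent
    through the drift of the agent j0, and every time step costs at most a
    through the quadratic terms.  So an old step gains a, and each of the at most
    M recent ones loses at most a. *)
Lemma expectation_expR_avg_llr_decay (j0 : 'I_n) (M : nat)
    (K lam delta c a : R) (k : nat) (i : 'I_n) :
  (forall j u, `|Y j u| <= K) -> 0 <= K -> 0 <= lam -> lam * K <= 2^-1 ->
  (forall t m i, (M <= m)%N -> delta <= transition A t m i j0) ->
  (forall j, \sum_u f j u * Y j u <= 0) ->
  0 <= c -> \sum_u f j0 u * Y j0 u <= - c ->
  n%:R * (2 * (lam * K) ^+ 2) <= a -> 2 * a <= lam * (delta * c) ->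
  (\int[P]_w (expR (lam * psi k i w))%:E <=
   (expR (2 * a * M%:R) * expR (- a) ^+ k)%:E)%E.
Proof.
move=> YK K0 lam0 lamK mixing drift c0 drift0 noise gap.
rewrite expectation_expR_avg_llr lee_fin.
have a0 : 0 <= a.
  by apply: le_trans noise; rewrite !mulr_ge0// sqr_ge0.
have W k' m := transition_row_stochastic A k' m A_stoch.
apply: (@le_trans _ _
  (\prod_(0 <= t < k) expR (- a + 2 * a * (k - t.+1 < M)%N%:R))).
  apply: ler_prod => t _.
  have [W0 W1] := W t.+1 (k - t.+1)%N.
  rewrite prodr_ge0/=; last first.
    move=> j _; have [f0 _] := f_pmf j.
    by rewrite sumr_ge0// => u _; rewrite mulr_ge0 ?expR_ge0.
  apply: le_trans (weighted_mgf_prod_le _ _ _ _ _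
    (fun j => transition A t.+1 (k - t.+1) i j) K lam f_pmf YK _ K0 lam0 lamK) _.
    move=> j; rewrite W0/= -(W1 i) (bigD1 j)//= lerDl.
    by rewrite sumr_ge0.
  rewrite ler_expR.
  have others : lam * (\sum_j transition A t.+1 (k - t.+1) i j *
      \sum_u f j u * Y j u) <=
      lam * (transition A t.+1 (k - t.+1) i j0 * \sum_u f j0 u * Y j0 u).
    rewrite ler_wpM2l// (bigD1 j0)//= gerDl sumr_le0// => j _.
    by rewrite mulr_ge0_le0.
  have [recent|old] := ltnP (k - t.+1) M.
    have : lam * (transition A t.+1 (k - t.+1) i j0 *
        \sum_u f j0 u * Y j0 u) <= 0 by rewrite mulr_ge0_le0// mulr_ge0_le0.
    by rewrite /= mulr1; lra.
  have : lam * (transition A t.+1 (k - t.+1) i j0 *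
      \sum_u f j0 u * Y j0 u) <= lam * (- (delta * c)).
    rewrite ler_wpM2l// -mulrN.
    apply: (@le_trans _ _ (transition A t.+1 (k - t.+1) i j0 * - c)).
      by rewrite ler_wpM2l.
    by rewrite ler_wnM2r ?oppr_le0// mixing.
  by rewrite /= mulr0 mulrN; lra.
rewrite -expR_sum -expRM_natr -expRD ler_expR big_split/= -mulr_sumr.
rewrite sumr_const_nat subn0 -[_ *+ k]mulr_natr -natr_sum addrC lerD2r.
by rewrite ler_wpM2l ?mulr_ge0// ler_nat sum_recent_le.
Qed.

End Decay.

(** * Almost sure rejection of the hypotheses that do not fit best *)

Theorem theorem1 (R : realType) (d : measure_display) (T : measurableType d)
    (P : probability T R)
    (n : nat) (Sig : 'I_n -> finType) (Theta : finType)
    (* signals: S k i is the observation of agent i at time k >= 1 *)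
    (S : nat -> forall i : 'I_n, T -> Sig i)
    (f : forall i : 'I_n, Sig i -> R)
    (l : forall i : 'I_n, Theta -> Sig i -> R)
    (mu0 : 'I_n -> Theta -> R)
    (* E k j i: edge (j, i) of the graph at time k *)
    (E : nat -> rel 'I_n) (A : nat -> 'M[R]_n)
    (f_pmf : forall i, is_pmf (f i))
    (l_pmf : forall i th, is_pmf (l i th))
    (mu0_pmf : forall i, is_pmf (mu0 i))
    (S_rv : forall k i, discrete_rv (S k.+1 i))
    (S_law : forall k i s, P (S k.+1 i @^-1` [set s]) = (f i s)%:E)
    (S_indep : mutually_independent P
       (fun ki : nat * 'I_n => S ki.1.+1 ki.2))
    (A_stoch : forall k, row_stochastic (A k))
    (A_edge : forall k i j, E k j i -> 0 < A k i j)
    (A_nonedge : forall k i j, i != j -> ~~ E k j i -> A k i j = 0)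
    (A_diag : forall k i, 0 < A k i i)
    (A_lower : exists2 eta : R, 0 < eta &
       forall k i j, 0 < A k i j -> eta < A k i j)
    (E_conn : exists2 B : nat, (1 <= B)%N & uniformly_strongly_connected E B)
    (best_nonempty : common_best_fit f l !=set0)
    (mu0_pos : forall i th, common_best_fit f l th -> 0 < mu0 i th)
    (l_lower : exists2 alpha : R, 0 < alpha &
       forall i th s, alpha < l i th s) :
  forall (th : Theta) (i : 'I_n), ~ common_best_fit f l th ->
    {ae P, forall w : T,
      belief l A mu0 (fun k j => S k j w) k i th @[k --> \oo] --> (0 : R)}.
Proof.
have [eta eta0 A_low] := A_lower; have [B B0 B_conn] := E_conn.
have [alpha alpha0 l_low] := l_lower; have [ths ths_best] := best_nonempty.
have l_gt0 i th s : 0 < l i th s by exact: lt_trans (l_low i th s).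
move=> th i th_bad.
pose Y : forall j, Sig j -> R := fun j => llr l th ths j.
have drift_le0 j : \sum_u f j u * Y j u <= 0.
  have := ths_best j I th.
  rewrite !kl_divergenceE// lee_fin.
  by rewrite (log_loss_drift _ _ _ _ (l j th) (f_pmf j))// gerDl.
have [j0 drift_lt0] : exists j0, \sum_u f j0 u * Y j0 u < 0.
  have /existsNP[j0 /not_implyP[_ /existsNP[th' /negP]]] := th_bad.
  rewrite -ltNge => th'_better; exists j0.
  have := le_lt_trans (ths_best j0 I th') th'_better.
  rewrite !kl_divergenceE// lte_fin.
  by rewrite (log_loss_drift _ _ _ _ (l j0 th) (f_pmf j0))// gtrDl.
pose c := - \sum_u f j0 u * Y j0 u.
have c_gt0 : 0 < c by rewrite oppr_gt0.
pose M := (n.+1 * B)%N; pose delta := eta ^+ M.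
have delta_gt0 : 0 < delta by rewrite exprn_gt0.
have mixing t m i' : (M <= m)%N -> delta <= transition A t m i' j0.
  exact: (transition_mixing A E B eta).
pose K := \sum_j \sum_u `|Y j u|.
have YK j u : `|Y j u| <= K.
  rewrite /K (bigD1 j)//= (bigD1 u)//= -addrA lerDl addr_ge0//.
    by rewrite sumr_ge0.
  by rewrite sumr_ge0// => j' _; rewrite sumr_ge0.
have K0 : 0 <= K by rewrite sumr_ge0// => j _; rewrite sumr_ge0.
(* The three terms of the denominator ensure lam <= 1, lam * K <= 1/2 and that
   the quadratic error n * 2 * (lam * K) ^ 2 is at most a. *)
pose lam := (1 + 2 * K + 4 * n%:R * K ^+ 2 / (delta * c))^-1.
pose a := lam * (delta * c) / 2.
(* exp C is at least 1 / mu0 j ths for every agent j. *)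
pose C := \sum_j - ln (mu0 j ths).
have gap_gt0 : 0 < delta * c by rewrite mulr_gt0.
have D_ge0 : 0 <= 4 * n%:R * K ^+ 2 / (delta * c).
  by rewrite divr_ge0 ?(ltW gap_gt0)// !mulr_ge0// exprn_ge0.
have D_gt0 : 0 < 1 + 2 * K + 4 * n%:R * K ^+ 2 / (delta * c) by lra.
have lam_gt0 : 0 < lam by rewrite invr_gt0.
have lamD : lam + lam * (2 * K) + lam * (4 * n%:R * K ^+ 2 / (delta * c)) = 1.
  by rewrite -[X in X + _ + _ = _]mulr1 -!mulrDr mulVf// gt_eqF.
have lamK0 : 0 <= lam * K by rewrite mulr_ge0// ltW.
have lamD0 : 0 <= lam * (4 * n%:R * K ^+ 2 / (delta * c)).
  by rewrite mulr_ge0// ltW.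
have lam01 : 0 <= lam <= 1 by apply/andP; split; lra.
have lamK_half : lam * K <= 2^-1 by lra.
have noise : n%:R * (2 * (lam * K) ^+ 2) <= a.
  have : lam * (4 * n%:R * K ^+ 2 / (delta * c)) <= 1 by lra.
  rewrite [leLHS]mulrA ler_pdivrMr// mul1r => h.
  have -> : n%:R * (2 * (lam * K) ^+ 2) =
            lam * (lam * (4 * n%:R * K ^+ 2)) / 2 by field.
  by rewrite ler_wpM2r// ler_wpM2l// ltW.
have a_gt0 : 0 < a by rewrite divr_gt0// mulr_gt0.
have mu0_ths j : 0 < mu0 j ths by exact: mu0_pos.
have prior_le j : mu0 j th <= expR C * mu0 j ths.
  have mu0_le1 j' th' : mu0 j' th' <= 1.
    have [mu_ge0 <-] := mu0_pmf j'.
    by rewrite (bigD1 th')//= lerDl sumr_ge0.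
  apply: (le_trans (mu0_le1 j th)).
  rewrite -[X in _ * X]lnK ?posrE// -expRD -expR0 ler_expR /C (bigD1 j)//=.
  rewrite addrAC addNr add0r sumr_ge0// => j' _.
  by rewrite oppr_ge0 ln_le0.
have rho01 : 0 <= expR (- a) < 1.
  by rewrite expR_ge0 expR_lt1 oppr_lt0.
pose psi w k := avg_llr A (fun t j => Y j (S t.+1 j w)) k i.
have decay k : (\int[P]_w (expR (lam * psi w k))%:E <=
    (expR (2 * a * M%:R) * expR (- a) ^+ k)%:E)%E.
  apply: (expectation_expR_avg_llr_decay P S f Y A f_pmf S_rv S_law S_indep
    A_stoch j0 M K lam delta c a) => //; first exact: ltW.
  - exact: ltW.
  - by rewrite opprK.
  - by rewrite mulrC divfK.
have psi_cvg0 : {ae P, forall w, expR (lam * psi w k) @[k --> \oo] --> (0 : R)}.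
  apply: summable_expectation_cvg0 rho01 decay.
    by move=> k; exact: expR_avg_llr_measurable.
  by move=> k w; exact: expR_ge0.
apply: filterS psi_cvg0 => w psi_w.
apply: (@squeeze_cvgr _ _ _ _ (fun=> 0)
  (fun k => expR (lam * C) * expR (lam * psi w k))).
- apply: nearW => k.
  have [mu_ge0 _] := belief_ge0_gt0 l A mu0 (fun k j => S k j w) ths l_gt0
    mu0_pmf mu0_ths k.
  rewrite mu_ge0/=.
  exact: belief_le_avg_llr.
- exact: cvg_cst.
- by rewrite -[X in _ --> X](mulr0 (expR (lam * C))); apply: cvgMr.
Qed.
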